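(* Let $(m_n)_n$ be a sequence of positive integers with $m_n\le n$ and $$\lim_{n\to\infty}\frac{m_n\log\log n}{\log n}=\infty .$$ Let $(A_n)_n$ be a sequence of random matrices on a common probability space, where $A_n$ is an $m_n\times n$ matrix ($m_n$ rows, $n$ columns) whose entries are positive, independent, and identically distributed as a random variable $\xi$ (whose distribution does not depend on $n$). Fix $0<\alpha<1$. (i) Almost surely $$\liminf_{n\to\infty}\ \min_{(k_1,k_2,B)}\frac{\log\operatorname{per}B}{k_1\log k_2}\ \ge\ 1,$$ where the minimum is over all pairs of integers $(k_1,k_2)$ with $\alpha m_n\le k_1\le m_n$, $\alpha n\le k_2\le n$ and $k_1\le k_2$, and all $k_1\times k_2$ submatrices $B$ of $A_n$. (ii) If $\xi$ has finite mean, then almost surely $$\limsup_{n\to\infty}\ \max_{(k_1,k_2,B)}\frac{\log\operatorname{per}B}{k_1\log k_2}\ =\ 1,$$ where the maximum is over all pairs of integers $(k_1,k_2)$ with $\alpha m_n\le k_1\le m_n$, $\alpha n\le k_2\le n$ and $k_1\le k_2$, and all $k_1\times k_2$ submatrices $B$ of $A_n$.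
   Context: For $m\le n$, the permanent of an $m\times n$ matrix $A=(a_{i,j})$ is $\operatorname{per}A=\sum_{\pi}\prod_{i=1}^m a_{i,\pi(i)}$, where the sum is over all one-to-one functions $\pi:\{1,\dots,m\}\to\{1,\dots,n\}$. A $k_1\times k_2$ submatrix of $A=(a_{i,j})$ is a matrix $(a_{i,j})_{i\in I,j\in J}$ with $I$ a set of $k_1$ row indices and $J$ a set of $k_2$ column indices. No assumption is made on the joint distribution of the matrices $A_n$ for different $n$. The quantities are considered for $n$ large enough that $\alpha n>1$. *)

(* Defs.v *)
From mathcomp Require Import all_boot all_order all_algebra.
From mathcomp Require Import all_classical all_reals all_analysis.

Set Implicit Arguments.
Unset Strict Implicit.
Unset Printing Implicit Defensive.

Import Order.TTheory GRing.Theory Num.Theory.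
Import numFieldNormedType.Exports.

Local Open Scope classical_set_scope.
Local Open Scope ring_scope.

Definition per (R : comNzRingType) (k l : nat) (A : 'M[R]_(k, l)) : R :=
  \sum_(f : {ffun 'I_k -> 'I_l} | injectiveb f) \prod_(i < k) A i (f i).

(* [enum_val] lists the indices in increasing order. *)
Definition submatrix (R : Type) (k l : nat) (A : 'M[R]_(k, l))
    (I : {set 'I_k}) (J : {set 'I_l}) : 'M[R]_(#|I|, #|J|) :=
  mxsub enum_val enum_val A.

Definition mutually_independent d (T : measurableType d) (R : realType)
    (P : probability T R) (I : finType) (X : I -> {RV P >-> R}) : Prop :=
  forall (S : {set I}) (B : I -> set R), (forall i, measurable (B i)) ->
    P [set w | forall i, i \in S -> B i (X i w)] =
    (\prod_(i in S) P (X i @^-1` B i))%E.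

(* [distribution] is only meaningful on measurable sets, so its values are not
   compared elsewhere; the variables may live on different spaces. *)
Definition identically_distributed d d' (T : measurableType d)
    (T' : measurableType d') (R : realType) (P : probability T R)
    (P' : probability T' R) (X : {RV P >-> R}) (Y : {RV P' >-> R}) : Prop :=
  forall B : set R, measurable B -> distribution P X B = distribution P' Y B.

(* A submatrix is given by its sets of rows and columns, so that
   k1 = #|IJ.1| and k2 = #|IJ.2|. *)
Definition admissible (R : realType) (alpha : R) (m n : nat)
    (IJ : {set 'I_m} * {set 'I_n}) : bool :=
  [&& alpha * m%:R <= #|IJ.1|%:R, alpha * n%:R <= #|IJ.2|%:R
    & (#|IJ.1| <= #|IJ.2|)%N].

Definition log_per_ratio (R : realType) (m n : nat) (A : 'M[R]_(m, n))
    (IJ : {set 'I_m} * {set 'I_n}) : R :=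
  ln (per (submatrix A IJ.1 IJ.2)) / (#|IJ.1|%:R * ln #|IJ.2|%:R).

(* The default values +oo and -oo are never returned when 1 <= m <= n and
   alpha <= 1, since the full matrix is then admissible. *)
Definition min_ratio (R : realType) (alpha : R) (m n : nat)
    (A : 'M[R]_(m, n)) : \bar R :=
  \big[mine/+oo%E]_(IJ : {set 'I_m} * {set 'I_n} | admissible alpha IJ)
    (log_per_ratio A IJ)%:E.

Definition max_ratio (R : realType) (alpha : R) (m n : nat)
    (A : 'M[R]_(m, n)) : \bar R :=
  \big[maxe/-oo%E]_(IJ : {set 'I_m} * {set 'I_n} | admissible alpha IJ)
    (log_per_ratio A IJ)%:E.

Definition random_matrix d (T : measurableType d) (R : realType)
    (P : probability T R) (m n : nat) (X : 'I_m -> 'I_n -> {RV P >-> R})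
    (w : T) : 'M[R]_(m, n) :=
  \matrix_(i, j) X i j w.

(* Main.v *)
(* Lower bound: for small delta, with overwhelming probability every row and
   every column of A_n has at most h = n / D entries <= delta, so deleting rows
   greedily as long as more than 2h columns remain, and then completing with a
   matching, gives every k1 x k2 submatrix at least h ^ min(k1, k2 - 2h)
   transversals of entries > delta.
   Upper bound: replace each entry x by a dyadic step function g(x) >= 1 with
   x <= g(x) <= 1 + 2x (up to a truncation).  Then per B <= n ^ k1 * W for all
   submatrices B at once, where W is the product over all rows of the mean of g
   along the row; by independence W has expectation at most C ^ m_n, and Markov's
   inequality suffices because m_n tends to infinity. *)
Require Import Defs.
From mathcomp Require Import all_boot all_order all_algebra.
From mathcomp Require Import all_classical all_reals all_analysis.
From mathcomp Require Import perm measurable_realfun zify ring lra.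

Set Implicit Arguments.
Unset Strict Implicit.
Unset Printing Implicit Defensive.

Import Order.TTheory GRing.Theory Num.Theory.
Import numFieldNormedType.Exports.

Local Open Scope ring_scope.

(** * Counting injections that use only good cells *)

(** This is the permanent of the 0-1 matrix of [G], kept as a natural number. *)
Definition num_injections k l (G : 'I_k -> 'I_l -> bool) : nat :=
  #|[set f : {ffun 'I_k -> 'I_l} | injectiveb f && [forall i, G i (f i)]]|.

(** One half of the Laplace expansion along the first row: [F] glues a column [j] to an injection of
    the minor avoiding it, and this gluing is injective. *)
Lemma num_injections_expand k l (G : 'I_k.+1 -> 'I_l.+1 -> bool) :
  (\sum_(j | G ord0 j)
     num_injections (fun i j' => G (lift ord0 i) (lift j j'))
   <= num_injections G)%N.
Proof.
pose F (p : 'I_l.+1 * {ffun 'I_k -> 'I_l}) : {ffun 'I_k.+1 -> 'I_l.+1} :=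
  [ffun i => if unlift ord0 i is Some i' then lift p.1 (p.2 i') else p.1].
have F0 p : F p ord0 = p.1 by rewrite ffunE unlift_none.
have FS p i : F p (lift ord0 i) = lift p.1 (p.2 i) by rewrite ffunE liftK.
have F_inj : injective F.
  move=> [j g] [j' g'] eF.
  have ej : j = j' by have := F0 (j, g); rewrite eF F0.
  subst j'; congr pair; apply/ffunP => i.
  by have := FS (j, g) i; rewrite eF FS /= => /lift_inj.
under eq_bigr => j _ do rewrite /num_injections -sum1_card.
rewrite pair_big_dep /= sum1_card.
rewrite -(card_imset _ F_inj).
apply/subset_leq_card/fintype.subsetP => f /imsetP[[j g] /andP[/= Gj]].
rewrite !inE => /andP[/injectiveP g_inj /forallP Gg] ->{f}.
apply/andP; split.
  apply/injectiveP => i i'.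
  case: (unliftP ord0 i) => [a ->|->]; case: (unliftP ord0 i') => [b ->|->];
    rewrite ?FS ?F0 //=.
  - by move=> /lift_inj/g_inj ->.
  - by move=> e; have := neq_lift j (g a); rewrite e eqxx.
  - by move=> e; have := neq_lift j (g b); rewrite -e eqxx.
apply/forallP => i; case: (unliftP ord0 i) => [a ->|->]; rewrite ?FS ?F0 //=.
Qed.

(* An injection with the largest possible number of good rows has no bad row:
   from a bad one, a transposition of two columns would gain a good row. *)
Lemma num_injections_gt0 h k l (G : 'I_k -> 'I_l -> bool) :
  (k <= l)%N -> (h.*2 <= l)%N ->
  (forall i, (#|[set j | ~~ G i j]| <= h)%N) ->
  (forall j, (#|[set i | ~~ G i j]| <= h)%N) ->
  (0 < num_injections G)%N.
Proof.
move=> kl hl rowG colG.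
pose f0 : {ffun 'I_k -> 'I_l} := [ffun i => widen_ord kl i].
have f0_inj : injectiveb f0.
  by apply/injectiveP => i j; rewrite !ffunE => /(congr1 val)/= /val_inj.
case: (@arg_maxnP _ f0 (fun f => injectiveb f)
  (fun f : {ffun 'I_k -> 'I_l} => #|[set i | G i (f i)]|) f0_inj).
move=> f /injectiveP f_inj f_max.
apply/card_gt0P; exists f; rewrite inE; apply/andP; split; first exact/injectiveP.
apply/forallP => i; apply/negPn/negP => Nfi.
(* [A] holds the columns bad for row [i], [B] the columns held by rows for which column [f i] is
   bad. Each has at most [h] elements and both contain [f i], so some column [j] lies outside
   [A :|: B]. *)
set A := [set j | ~~ G i j]; set B := f @: [set i' | ~~ G i' (f i)].
have AB : (#|A :|: B| < l)%N.
  have AiB : f i \in A :&: B.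
    by rewrite !inE Nfi/=; apply/imsetP; exists i; rewrite ?inE.
  have : (0 < #|A :&: B|)%N by apply/card_gt0P; exists (f i).
  have hA : (#|A| <= h)%N := rowG i.
  have hB : (#|B| <= h)%N := leq_trans (leq_imset_card _ _) (colG (f i)).
  rewrite cardsU; have l_gt0 := ltn_ord (f i); move: hA hB l_gt0.
  by move: #|A| #|B| #|_ :&: _| => a b c; lia.
have [j] : exists j, j \notin A :|: B.
  apply/existsP; rewrite -negb_forall; apply/negP => /forallP AB1.
  move: AB; suff -> : #|A :|: B| = l by rewrite ltnn.
  by rewrite -[RHS]card_ord; apply: eq_card => j; rewrite AB1.
rewrite finset.in_setU negb_or inE negbK => /andP[Gij NB].
(* Exchanging [f i] and [j] makes row [i] good, and the row that held [j], if any, stays good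
   because [j] is not in [B]. *)
have f'_inj : injectiveb [ffun x => tperm (f i) j (f x)].
  by apply/injectiveP => x y; rewrite !ffunE => /perm_inj/f_inj.
have := f_max _ f'_inj; apply/negP; rewrite -ltnNge.
apply: proper_card; apply/properP; split; last first.
  by exists i; rewrite inE ?(negbTE Nfi)// ffunE tpermL.
apply/fintype.subsetP => x; rewrite !inE ffunE => Gx.
case: tpermP => [/f_inj xi|fxj|//]; first by rewrite -xi Gx in Nfi.
apply/negPn/negP => Nx; case/negP: NB.
by apply/imsetP; exists x; rewrite ?inE.
Qed.

(** While [2h <= l], the first row has at least [l - h >= h] good columns. Deleting the row and one
    of these columns can only decrease the counts of bad cells, so the same [h] serves in the
    induction. *)
Lemma num_injections_ge h k l (G : 'I_k -> 'I_l -> bool) :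
  (k <= l)%N -> (h.*2 <= l)%N ->
  (forall i, (#|[set j | ~~ G i j]| <= h)%N) ->
  (forall j, (#|[set i | ~~ G i j]| <= h)%N) ->
  (h ^ minn k (l - h.*2) <= num_injections G)%N.
Proof.
elim: k l G => [|k IHk] l G kl hl rowG colG.
  by rewrite min0n expn0 (num_injections_gt0 kl hl rowG colG).
(* Here [l = 2h]: one more deletion would break [h.*2 <= l], so the existence of a single good
   injection concludes. *)
have [->|] := eqVneq (l - h.*2)%N 0%N.
  by rewrite minn0 expn0 (num_injections_gt0 kl hl rowG colG).
case: l G kl hl rowG colG => [//|l] G kl hl rowG colG hl'.
apply: leq_trans (num_injections_expand G).
have -> : minn k.+1 (l.+1 - h.*2) = (minn k (l - h.*2)).+1 by lia.
rewrite expnS; apply: (@leq_trans (\sum_(j | G ord0 j) h ^ minn k (l - h.*2))).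
  rewrite sum_nat_const leq_mul2r; apply/orP; right.
  have := rowG ord0.
  have -> : [set j | ~~ G ord0 j] = ~: [set j | G ord0 j]
    by apply/finset.setP => j; rewrite !inE.
  have := cardsC [set j | G ord0 j]; rewrite card_ord cardsE; lia.
apply: leq_sum => j _; apply: IHk; first exact: kl.
- lia.
- move=> i; apply: leq_trans (rowG (lift ord0 i)).
  rewrite -(card_imset _ (@lift_inj _ j)); apply/subset_leq_card/fintype.subsetP => y.
  by case/imsetP => x; rewrite !inE => Gx ->.
- move=> j'; apply: leq_trans (colG (lift j j')).
  rewrite -(card_imset _ (@lift_inj _ ord0)); apply/subset_leq_card/fintype.subsetP
      => y.
  by case/imsetP => x; rewrite !inE => Gx ->.
Qed.

(** * Deterministic bounds for permanents of submatrices *)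

Section DeterministicBounds.
Variable R : realType.

Lemma per_ge k l (A : 'M[R]_(k, l)) (delta : R) :
  0 <= delta -> (forall i j, 0 <= A i j) ->
  delta ^+ k * (num_injections (fun i j => delta < A i j))%:R <= per A.
Proof.
move=> d0 A0; rewrite /per /num_injections -sum1_card natr_sum mulr_sumr.
rewrite [leRHS](bigID (fun f : {ffun 'I_k -> 'I_l} => [forall i, delta < A i
    (f i)])) /=.
rewrite -[leLHS]addr0 lerD ?sumr_ge0//; last by move=> *; exact: prodr_ge0.
under eq_bigl do rewrite inE.
apply: ler_sum => f /andP[_ /forallP fA]; rewrite mulr1.
rewrite -[k in _ ^+ k]card_ord -prodr_const.
by apply: ler_prod => i _; rewrite d0/= ltW.
Qed.

Lemma per_submatrix_ge h m n (A : 'M[R]_(m, n)) (delta : R)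
    (I : {set 'I_m}) (J : {set 'I_n}) :
  0 <= delta -> (forall i j, 0 <= A i j) ->
  (forall i, (#|[set j | (A i j <= delta)%R]| <= h)%N) ->
  (forall j, (#|[set i | (A i j <= delta)%R]| <= h)%N) ->
  (#|I| <= #|J|)%N -> (h.*2 <= #|J|)%N ->
  delta ^+ #|I| * (h ^ minn #|I| (#|J| - h.*2))%:R <= per (submatrix A I J).
Proof.
move=> d0 A0 rowA colA IJ hJ.
apply: le_trans (per_ge d0 _); last by move=> i j; rewrite mxE.
rewrite ler_wpM2l ?exprn_ge0// ler_nat; apply: num_injections_ge => // [i|j].
- apply: leq_trans (rowA (enum_val i)).
  rewrite -(card_imset _ (@enum_val_inj _ _)).
  apply/subset_leq_card/fintype.subsetP => y /imsetP[j].
  by rewrite !inE mxE -leNgt => Aij ->.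
- apply: leq_trans (colA (enum_val j)).
  rewrite -(card_imset _ (@enum_val_inj _ _)).
  apply/subset_leq_card/fintype.subsetP => y /imsetP[i].
  by rewrite !inE mxE -leNgt => Aij ->.
Qed.

(** Dropping injectivity turns the permanent into a product of row sums; these are then extended to
    all columns, which removes [J] from the bound. *)
Lemma per_submatrix_le m n (A B : 'M[R]_(m, n))
    (I : {set 'I_m}) (J : {set 'I_n}) :
  (forall i j, 0 <= A i j <= B i j) ->
  per (submatrix A I J) <= \prod_(i in I) \sum_j B i j.
Proof.
move=> AB.
have A0 i j : 0 <= A i j by have /andP[] := AB i j.
have B0 i j : 0 <= B i j by apply: le_trans (A0 i j) _; have /andP[] := AB i j.
have S0 i j : 0 <= submatrix A I J i j by rewrite mxE.
apply: (@le_trans _ _ (\prod_i \sum_j submatrix A I J i j)).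
  rewrite bigA_distr_bigA/= /per [leRHS](bigID (fun f : {ffun _ -> _} =>
      injectiveb f))/=.
  by rewrite lerDl sumr_ge0// => f _; exact: prodr_ge0.
rewrite [leRHS]big_enum_val; apply: ler_prod => i _; rewrite sumr_ge0//=.
apply: (@le_trans _ _ (\sum_(j in J) B (enum_val i) j)).
  rewrite [leRHS]big_enum_val; apply: ler_sum => j _; rewrite mxE.
  by have /andP[] := AB (enum_val i) (enum_val j).
by rewrite [leRHS](bigID (mem J))/= lerDl sumr_ge0.
Qed.

(** Since [B >= 1], every row mean is at least 1, so the product may run over all rows. That factor
    is then the same for all submatrices, and no union bound over them is required. *)
Lemma per_submatrix_le_mean m n (A B : 'M[R]_(m, n))
    (I : {set 'I_m}) (J : {set 'I_n}) :
  (0 < n)%N -> (forall i j, 0 <= A i j <= B i j) -> (forall i j, 1 <= B i j) ->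
  per (submatrix A I J) <=
  n%:R ^+ #|I| * \prod_i (n%:R^-1 * \sum_j B i j).
Proof.
move=> n0 AB B1; apply: le_trans (per_submatrix_le _ _ AB) _.
have nR0 : 0 < n%:R :> R by rewrite ltr0n.
have avg1 i : 1 <= n%:R^-1 * \sum_j B i j.
  rewrite ler_pdivlMl// mulr1 -[n in n%:R]card_ord -sumr_const.
  exact: ler_sum.
rewrite [X in _ * X](bigID (mem I))/= mulrA.
have -> : n%:R ^+ #|I| * \prod_(i in I) (n%:R^-1 * \sum_j B i j)
    = \prod_(i in I) \sum_j B i j.
  by rewrite -prodr_const -big_split/=; apply: eq_bigr => i _; rewrite mulVKf ?gt_eqF.
apply: ler_peMr; last first.
  by elim/big_ind: _ => // x y; exact: mulr_ege1.
by apply: prodr_ge0 => i _; apply: sumr_ge0 => j _; exact: le_trans (B1 i j).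
Qed.

Lemma near_ln_ge (K : R) : \forall n \near \oo%classic, K <= ln (n%:R : R).
Proof.
near=> n; rewrite -(expRK K) ler_ln ?posrE ?expR_gt0//; near: n.
  exact: nbhs_infty_ger.
by near=> n; rewrite ltr0n; near: n; exact: nbhs_infty_gt.
Unshelve. all: by end_near. Qed.

(** With [h = n %/ D], the condition on [D] gives [4h <= eps * k2], so the exponent
    [min(k1, k2 - 2h)] is at least [(1 - eps / 2) * k1]. The other half of [eps] pays for
    [delta ^+ k1] and for replacing [ln h] by [ln n]. The threshold on [n] is uniform in [m] and
    [A]. *)
Lemma log_per_ratio_ge (alpha eps delta : R) (D : nat) :
  0 < alpha -> 0 < eps <= 1 -> 0 < delta ->
  4 + 2 * eps <= eps * alpha * D%:R ->
  \forall n \near \oo%classic, forall (m : nat) (A : 'M[R]_(m, n))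
      (IJ : {set 'I_m} * {set 'I_n}),
    (0 < m)%N -> (forall i j, 0 <= A i j) ->
    (forall i, (#|[set j | (A i j <= delta)%R]| <= n %/ D)%N) ->
    (forall j, (#|[set i | (A i j <= delta)%R]| <= n %/ D)%N) ->
    admissible alpha IJ -> 1 - eps <= log_per_ratio A IJ.
Proof.
move=> a0 /andP[e0 e1] d0 hD.
have D0 : 0 < D%:R :> R.
  by rewrite -(pmulr_rgt0 _ (mulr_gt0 e0 a0)) (lt_le_trans _ hD)// addr_gt0// mulr_gt0.
near=> n => m A [I J] m0 A0 rowA colA.
rewrite /admissible /log_per_ratio /= => /and3P[I_ge J_ge IJ].
set h := (n %/ D)%N in rowA colA *.
set k1 : R := #|I|%:R; set k2 : R := #|J|%:R.
have n_big : 2 * D%:R <= n%:R :> R by near: n; exact: nbhs_infty_ger.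
have n_big2 : 2 <= alpha * n%:R.
  by rewrite mulrC -ler_pdivrMr//; near: n; exact: nbhs_infty_ger.
have n0 : 0 < n%:R :> R by rewrite (lt_le_trans _ n_big)// mulr_gt0.
have k1_gt0 : 0 < k1 by rewrite (lt_le_trans _ I_ge)// mulr_gt0// ltr0n.
have k2_ge2 : 2 <= k2 by apply: le_trans J_ge.
have lnk2_gt0 : 0 < ln k2 by rewrite ln_gt0// (lt_le_trans _ k2_ge2)// ltr1n.
have k2n : k2 <= n%:R by rewrite ler_nat -[X in (_ <= X)%N]card_ord max_card.
have hDn : h%:R * D%:R <= n%:R :> R by rewrite -natrM ler_nat leq_divM.
(* Rounding down costs at most a factor 2 once [n >= 2D]. *)
have h_ge : n%:R / (2 * D%:R) <= h%:R :> R.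
  rewrite ler_pdivrMr ?mulr_gt0//.
  have : n%:R < h.+1%:R * D%:R :> R.
    by rewrite -natrM ltr_nat ltn_ceil// -(ltr0n R).
  rewrite -natr1; nra.
have h0 : 0 < h%:R :> R by rewrite (lt_le_trans _ h_ge)// divr_gt0// mulr_gt0.
have hkey : (4 + 2 * eps) * h%:R <= eps * (alpha * n%:R).
  apply: (@le_trans _ _ (eps * alpha * D%:R * h%:R)); first by rewrite ler_wpM2r// ltW.
  rewrite -[_ * D%:R * _]mulrA [D%:R * _]mulrC [leRHS]mulrA ler_wpM2l// mulr_ge0//
      ltW//.
have h2J : (h.*2 <= #|J|)%N.
  rewrite -(ler_nat R) -muln2 natrM; apply: le_trans J_ge.
  nra.
have M_ge : (1 - eps / 2) * k1 <= (minn #|I| (#|J| - h.*2))%:R.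
  case: (leqP #|I| (#|J| - h.*2)) => [_|Ilt].
    by rewrite -/k1; nra.
  have : (k2 - 2 * h%:R) <= k1.
    have : (#|J| <= #|I| + h.*2)%N by rewrite addnC -leq_subLR ltnW.
    by rewrite -(ler_nat R) natrD -muln2 natrM -/k1 -/k2 => ?; lra.
  have : k1 <= k2 by rewrite ler_nat.
  rewrite natrB// -muln2 natrM -/k2.
  move: J_ge; rewrite -/k2 => ? ? ?; nra.
have lnh_ge : ln n%:R - ln (2 * D%:R) <= ln (h%:R : R).
  rewrite -ln_div ?posrE ?mulr_gt0//.
  by rewrite ler_ln ?posrE// divr_gt0// mulr_gt0.
have lnh0 : 0 <= ln (h%:R : R) by rewrite ln_ge0// ler1n -(ltr0n R).
(* This is the last inequality of the proof, solved for [ln n]. *)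
have lnd : 2 / eps * ((1 - eps / 2) * ln (2 * D%:R) - ln delta) <= ln (n%:R : R).
  by near: n; exact: near_ln_ge.
have := per_submatrix_ge (ltW d0) A0 rowA colA IJ h2J.
rewrite -ler_ln ?posrE; last 2 first.
- by rewrite mulr_gt0 ?exprn_gt0// ltr0n expn_gt0 -(ltr0n R) h0.
- apply: lt_le_trans (per_submatrix_ge (ltW d0) A0 rowA colA IJ h2J).
  by rewrite mulr_gt0 ?exprn_gt0// ltr0n expn_gt0 -(ltr0n R) h0.
rewrite lnM ?posrE ?exprn_gt0//; last by rewrite ltr0n expn_gt0 -(ltr0n R) h0.
rewrite natrX !lnXn// -![ln _ *+ _]mulr_natr -/k1 => perB.
rewrite ler_pdivlMr ?mulr_gt0//; apply: le_trans perB.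
apply: (@le_trans _ _ ((1 - eps) * (k1 * ln n%:R))).
  by rewrite ler_wpM2l ?subr_ge0// ler_pM2l// ler_ln ?posrE// (lt_le_trans _ k2_ge2).
apply: (@le_trans _ _ (ln delta * k1 + ln h%:R * ((1 - eps / 2) * k1))); last first.
  by rewrite lerD2l ler_wpM2l.
rewrite (_ : _ + _ = (ln delta + (1 - eps / 2) * ln h%:R) * k1); last by ring.
rewrite mulrCA mulrC ler_pM2r//.
apply: (@le_trans _ _ (ln delta + (1 - eps / 2) * (ln n%:R - ln (2 * D%:R))));
    last first.
  by rewrite lerD2l ler_wpM2l// subr_ge0 ler_pdivrMr; lra.
move: lnd; rewrite mulrAC ler_pdivrMr// ; lra.
Unshelve. all: by end_near. Qed.

(** Half of [eps] absorbs the exponential factor, as [alpha * m <= k1]; the other half absorbs the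
    passage from [ln n] to [ln k2 >= ln n + ln alpha]. *)
Lemma log_per_ratio_le (alpha eps : R) :
  0 < alpha -> 0 < eps ->
  \forall n \near \oo%classic, forall (m : nat) (A : 'M[R]_(m, n))
      (IJ : {set 'I_m} * {set 'I_n}),
    (0 < m)%N ->
    per (submatrix A IJ.1 IJ.2) <=
      n%:R ^+ #|IJ.1| * expR (eps * alpha / 2 * m%:R * ln n%:R) ->
    admissible alpha IJ -> log_per_ratio A IJ <= 1 + eps.
Proof.
move=> a0 e0; near=> n => m A [I J] m0.
rewrite /admissible /log_per_ratio /= => per_le /and3P[I_ge J_ge IJ].
set k1 : R := #|I|%:R; set k2 : R := #|J|%:R.
have n_big2 : 2 <= alpha * n%:R.
  by rewrite mulrC -ler_pdivrMr//; near: n; exact: nbhs_infty_ger.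
have n1 : 1 <= n%:R :> R by near: n; exact: nbhs_infty_ger.
have n0 : 0 < n%:R :> R by exact: lt_le_trans n1.
have k1_gt0 : 0 < k1 by rewrite (lt_le_trans _ I_ge)// mulr_gt0// ltr0n.
have k2_ge2 : 2 <= k2 by apply: le_trans J_ge.
have lnk2_gt0 : 0 < ln k2 by rewrite ln_gt0// (lt_le_trans _ k2_ge2)// ltr1n.
have lnn0 : 0 <= ln (n%:R : R) by exact: ln_ge0.
have ln_per : ln (per (submatrix A I J)) <= k1 * ln n%:R + eps * alpha / 2 * m%:R *
    ln n%:R.
  (* No sign is known for [A] here; at a nonpositive permanent [ln] takes its default value 0. *)
  have [per0|per0] := leP (per (submatrix A I J)) 0.
    by rewrite ln0// addr_ge0// !mulr_ge0// ?divr_ge0// ?ltW// mulr_ge0// ltW.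
  have -> : k1 * ln n%:R = ln (n%:R ^+ #|I|) by rewrite lnXn// mulr_natl.
  rewrite -[X in _ + X]expRK -lnM ?posrE ?exprn_gt0 ?expR_gt0//.
  by rewrite ler_ln ?posrE// mulr_gt0 ?exprn_gt0 ?expR_gt0.
have lna : 2 / eps * (1 + eps) * - ln alpha <= ln (n%:R : R).
  by near: n; exact: near_ln_ge.
rewrite ler_pdivrMr ?mulr_gt0//; apply: le_trans ln_per _.
apply: (@le_trans _ _ ((1 + eps / 2) * (k1 * ln n%:R))).
  rewrite mulrDl mul1r lerD2l mulrA ler_wpM2r//.
  by have := ler_wpM2l (ltW e0) I_ge; rewrite -/k1; lra.
apply: (@le_trans _ _ ((1 + eps) * (k1 * (ln n%:R + ln alpha)))); last first.
  rewrite ler_wpM2l ?addr_ge0// ?(ltW e0)// ler_pM2l// -lnM ?posrE// mulrC.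
  by rewrite ler_ln ?posrE// ?mulr_gt0// (lt_le_trans _ k2_ge2).
rewrite ![_ * (k1 * _)]mulrCA ler_pM2l//.
move: lna; rewrite -mulrA mulrAC ler_pdivrMr//; lra.
Unshelve. all: by end_near. Qed.

End DeterministicBounds.

Local Open Scope classical_set_scope.

(** * Eventual bounds pass to lower and upper limits *)

Section Sequences.
Variable R : realType.

Lemma limn_einf_ge (u : (\bar R)^nat) (c : \bar R) :
  (\forall n \near \oo, c <= u n)%E -> (c <= limn_einf u)%E.
Proof.
move=> [N _ cu]; rewrite limn_einf_lim.
apply: lime_ge; first exact: is_cvg_einfs.
exists N => // n /= Nn; apply: le_ereal_inf_tmp => _ [k /= nk <-].
exact/cu/(leq_trans Nn).
Qed.

Lemma limn_esup_le (u : (\bar R)^nat) (c : \bar R) :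
  (\forall n \near \oo, u n <= c)%E -> (limn_esup u <= c)%E.
Proof.
move=> [N _ cu]; rewrite limn_esup_lim.
apply: lime_le; first exact: is_cvg_esups.
exists N => // n /= Nn; apply: ge_ereal_sup => _ [k /= nk <-].
exact/cu/(leq_trans Nn).
Qed.

End Sequences.

(** * Bounds on outer probability and the first Borel-Cantelli lemma *)

Section OuterBound.
Context d (T : measurableType d) (R : realType) (P : probability T R).

(* [E] has outer probability at most [r], so that [E] need not be measurable. *)
Definition prob_le (E : set T) (r : R) : Prop :=
  exists F, [/\ measurable F, E `<=` F & (P F <= r%:E)%E].

Lemma prob_leW (E E' : set T) (r r' : R) :
  E' `<=` E -> r <= r' -> prob_le E r -> prob_le E' r'.
Proof.
move=> EE' rr' [F [mF EF PF]]; exists F; split => //.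
- exact: subset_trans EF.
- by apply: le_trans PF _; rewrite lee_fin.
Qed.

Lemma prob_le_bigU (I : finType) (Q : pred I) (E : I -> set T) (r : I -> R) :
  (forall i, Q i -> prob_le (E i) (r i)) ->
  prob_le [set w | exists2 i, Q i & E i w] (\sum_(i | Q i) r i).
Proof.
move=> Er.
have /choice[F HF] : forall i, exists F, Q i -> [/\ measurable F, E i `<=` F &
    (P F <= (r i)%:E)%E].
  move=> i; case: (boolP (Q i)) => [/Er[F HF]|_]; last by exists set0.
  by exists F.
exists (\big[setU/set0]_(i | Q i) F i); split.
- by apply: bigsetU_measurable => i Qi; have [] := HF i Qi.
- move=> w [i Qi Eiw]; rewrite (bigD1 i Qi)/=; left.
  by have [_ + _] := HF i Qi; exact.
suff [] : measurable (\big[setU/set0]_(i | Q i) F i) /\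
    (P (\big[setU/set0]_(i | Q i) F i) <= (\sum_(i | Q i) r i)%:E)%E by [].
elim/big_rec2: _ => [|i y x Qi [mx Px]]; first by rewrite measure0.
have [mF _ PF] := HF i Qi.
split; first exact: measurableU.
by apply: le_trans (measureU2 _ mF mx) _; rewrite EFinD leeD.
Qed.

Lemma prob_leU (E E' : set T) (r r' : R) :
  prob_le E r -> prob_le E' r' -> prob_le (E `|` E') (r + r').
Proof.
move=> [F [mF EF PF]] [F' [mF' EF' PF']]; exists (F `|` F'); split.
- exact: measurableU.
- exact: setUSS.
- by apply: le_trans (measureU2 _ mF mF') _; rewrite EFinD leeD.
Qed.

(** For [n >= 1], [1 / n^2 <= 6 / ((n + 1)(n + 2))], with equality at [n = 1]; the right side
    telescopes, so the measurable covers have summable probabilities. *)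
Lemma Borel_Cantelli (E : (set T)^nat) (C : R) :
  (\forall n \near \oo, prob_le (E n) (C / n%:R ^+ 2)) ->
  {ae P, forall w, \forall n \near \oo, ~ E n w}.
Proof.
move=> [N _ EC].
have C0 : 0 <= C.
  have [F [mF _ PF]] := EC N.+1 (leqnSn N).
  have : (0 <= (C / N.+1%:R ^+ 2)%:E)%E by apply: le_trans PF; exact: measure_ge0.
  by rewrite lee_fin pmulr_lge0// invr_gt0 exprn_gt0.
(* Up to [N] the cover is empty; the bound is written as a difference, ready for telescoping. *)
have /choice[F HF] : forall n, exists F, [/\ measurable F, (N < n)%N -> E n `<=` F
    & (P F <= ((- (6 * C) / n.+2%:R) - (- (6 * C) / n.+1%:R))%:E)%E].
  have eqr n : (- (6 * C) / n.+2%:R) - (- (6 * C) / n.+1%:R) =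
      6 * C / (n.+1%:R * n.+2%:R) :> R.
    rewrite -(natr1 n.+1); have : n.+1%:R != 0 :> R by [].
    have : n.+1%:R + 1 != 0 :> R by rewrite natr1.
    by move=> *; field; apply/andP.
  move=> n; rewrite eqr; case: (leqP n N) => [_|Nn].
    by exists set0; split => //; rewrite measure0 lee_fin divr_ge0// mulr_ge0.
  have [F [mF EF PF]] := EC n (ltnW Nn); exists F; split => //.
  apply: le_trans PF _; rewrite lee_fin mulrAC mulrC ler_wpM2r//.
  rewrite ler_pdivlMr// ler_pdivrMl ?exprn_gt0 ?ltr0n//; last by lia.
  have : 1 <= n%:R :> R by rewrite ler1n; lia.
  rewrite -(natr1 n.+1) -natr1; nra.
have mF n : measurable (F n) by have [] := HF n.
exists (lim_sup_set F); split.
- apply: bigcap_measurable => // n _; exact: bigcup_measurable.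
- apply: lim_sup_set_cvg0 => //; apply: (@le_lt_trans _ _ (6 * C)%:E); last exact: ltry.
  apply: lime_le; first by apply: is_cvg_nneseries => n _ _; exact: measure_ge0.
  near=> n; apply: (@le_trans _ _ (\sum_(0 <= k < n) ((- (6 * C) / k.+2%:R) - (-
      (6 * C) / k.+1%:R))%:E)%E).
    by apply: lee_sum => k _; have [] := HF k.
  rewrite sumEFin lee_fin (telescope_sumr (fun k => - (6 * C) / k.+1%:R))//.
  by rewrite divr1 opprK gerDr mulNr oppr_le0 divr_ge0// mulr_ge0.
- move=> w /= Hw n _; apply: contrapT => NF; apply: Hw.
  exists (maxn n N.+1) => // k /=; rewrite geq_max => /andP[nk Nk] Ekw; apply: NF.
  by exists k => //; have [_ + _] := HF k; apply.
Unshelve. all: by end_near. Qed.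

End OuterBound.

(** * Union bound for lines with many small entries, and Markov's inequality *)

Section RandomMatrices.
Context d (T : measurableType d) (R : realType) (P : probability T R).

(** Union bound over the at most [2 ^ #|J|] sets of more than [h] positions: by independence, the
    entries on such a set are all small with probability at most [p ^+ h]. The map [phi] embeds one
    line into the whole independent family. *)
Lemma prob_le_count_le (I J : finType) (X : I -> {RV P >-> R}) (phi : J -> I)
    (h : nat) (delta p : R) :
  mutually_independent X -> injective phi -> 0 <= p <= 1 ->
  (forall i, P (X i @^-1` `]-oo, delta]) = p%:E) ->
  prob_le P [set w | h < #|[set j | (X (phi j) w <= delta)%R]%SET|]%N
    (2 ^+ #|J| * p ^+ h).
Proof.
move=> X_indep phi_inj /andP[p0 p1] Xp.
pose E (S : {set J}) := [set w | forall i, i \in (phi @: S)%SET -> `]-oo,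
    delta]%classic (X i w)].
have PE S : prob_le P (E S) (p ^+ #|S|).
  exists (E S); split => //.
    rewrite /E (_ : [set w | _] = \bigcap_(i in [set` (phi @: S)%SET])
        (X i @^-1` `]-oo, delta])).
      apply: fin_bigcap_measurable => // i _.
      by rewrite -[X in measurable X]setTI; exact: measurable_funP.
    by apply/seteqP; split=> w Hw i; exact: Hw.
  rewrite (X_indep (phi @: S)%SET (fun=> `]-oo, delta]))//.
  rewrite (eq_bigr (fun=> p%:E)) => [|i _]; last exact: Xp.
  by rewrite prodEFin lee_fin prodr_const card_imset.
have := @prob_le_bigU _ _ _ P _ (fun S : {set J} => h < #|S|)%N E _ (fun S _ => PE S).
apply: prob_leW => [w /= hw|].
  exists [set j | X (phi j) w <= delta]%SET => // _ /imsetP[j + ->].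
  by rewrite inE /= in_itv.
apply: (@le_trans _ _ (\sum_(S : {set J}) p ^+ h)); last first.
  rewrite sumr_const.
  have -> : #|{: {set J}}| = (2 ^ #|J|)%N.
    rewrite -[#|J|]cardsT -card_powerset; apply: eq_card => S.
    by rewrite !inE finset.subsetT.
  by rewrite -[leLHS]mulr_natl natrX.
rewrite [leRHS](bigID (fun S : {set J} => h < #|S|)%N)/= -[leLHS]addr0 lerD//.
  by apply: ler_sum => S /ltnW hS; exact: ler_wiXn2l.
by apply: sumr_ge0 => S _; exact: exprn_ge0.
Qed.

Lemma prob_le_bad_line (m n h : nat) (X : 'I_m -> 'I_n -> {RV P >-> R})
    (delta p : R) :
  (m <= n)%N -> mutually_independent (fun ij : 'I_m * 'I_n => X ij.1 ij.2) ->
  0 <= p <= 1 -> (forall i j, P (X i j @^-1` `]-oo, delta]) = p%:E) ->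
  prob_le P
    [set w | ~ ((forall i, #|[set j | (X i j w <= delta)%R]%SET| <= h)%N /\
                (forall j, #|[set i | (X i j w <= delta)%R]%SET| <= h)%N)]
    (2 * n%:R * 2 ^+ n * p ^+ h).
Proof.
move=> mn X_indep p01 Xp; have [p0 p1] := andP p01.
have ph0 : 0 <= p ^+ h by exact: exprn_ge0.
have row i : prob_le P [set w | h < #|[set j | (X i j w <= delta)%R]%SET|]%N
    (2 ^+ n * p ^+ h).
  have := @prob_le_count_le _ _ _ (fun j : 'I_n => (i, j)) h delta p X_indep _ p01
      (fun ij => Xp ij.1 ij.2).
  by rewrite card_ord; apply => j j' [].
have col j : prob_le P [set w | h < #|[set i | (X i j w <= delta)%R]%SET|]%N
    (2 ^+ n * p ^+ h).
  have := @prob_le_count_le _ _ _ (fun i : 'I_m => (i, j)) h delta p X_indep _ p01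
      (fun ij => Xp ij.1 ij.2).
  rewrite card_ord => /(_ (fun i i' e => congr1 fst e)); apply: prob_leW => //.
  by rewrite ler_wpM2r// ler_weXn2l// ler1n.
have := prob_leU (prob_le_bigU (Q := predT) (fun i _ => row i)) (prob_le_bigU (Q :=
    predT) (fun j _ => col j)).
apply: prob_leW.
  move=> w /= /not_andP[]/existsNP[i /negP]; rewrite -ltnNge => hi.
    by left; exists i.
  by right; exists i.
rewrite !sumr_const !card_ord -[_ *+ m]mulr_natl -[_ *+ n]mulr_natl.
rewrite -[leRHS]mulrA.
have mnR : m%:R <= n%:R :> R by rewrite ler_nat.
have := ler_wpM2r (mulr_ge0 (exprn_ge0 n (ler0n R 2)) ph0) mnR.
move: (2 ^+ n * p ^+ h) => z; lra.
Qed.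

(** Stated for a combination of indicators, whose mean is a finite sum of given probabilities. *)
Lemma prob_le_Markov (S : finType) (c : S -> R) (E : S -> set T) (r : S -> R) (t : R) :
  (forall s, 0 <= c s) -> (forall s, measurable (E s)) ->
  (forall s, P (E s) = (r s)%:E) -> 0 < t ->
  prob_le P [set w | t < \sum_s c s * \1_(E s) w] ((\sum_s c s * r s) / t).
Proof.
move=> c0 mE Er t0.
pose W w := (\sum_s c s * \1_(E s) w).
have mW : measurable_fun setT W.
  apply: measurable_sum => s; apply: measurable_funM => //.
have W0 w : 0 <= W w by apply: sumr_ge0 => s _; rewrite mulr_ge0.
have mA : measurable [set w | t < W w].
  have := mW measurableT `]t, +oo[%classic (measurable_itv _).
  by rewrite setTI /preimage; under eq_set do rewrite /= in_itv/= andbT.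
have intW : (\int[P]_w (W w)%:E = (\sum_s c s * r s)%:E)%E.
  under eq_integral do rewrite -sumEFin.
  rewrite ge0_integral_sum//; last 2 first.
  - move=> s; apply/measurable_EFinP; apply: measurable_funM => //.
  - by move=> s w _; rewrite lee_fin mulr_ge0.
  rewrite -sumEFin; apply: eq_bigr => s _.
  under eq_integral do rewrite EFinM.
  rewrite ge0_integralZl_EFin//; last first.
  - by apply/measurable_EFinP; exact: measurable_indic.
  by rewrite integral_indic// setIT EFinM; congr (_ * _)%E; exact: Er.
exists [set w | t < W w]; split => //.
rewrite EFinM -intW lee_pdivlMr// muleC.
rewrite -[X in P X]setIT -integral_indic// -ge0_integralZl_EFin//; last 2 first.
- by apply/measurable_EFinP; exact: measurable_indic.
- exact: ltW.
apply: ge0_le_integral => //.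
- by move=> w _; rewrite mule_ge0 ?lee_fin// ltW.
- apply/measurable_EFinP; apply: measurable_funM => //.
- exact/measurable_EFinP.
move=> w _; rewrite -EFinM lee_fin indicE.
by case: (boolP (w \in _)) => [/set_mem /= Aw|_]; rewrite ?mulr1 ?mulr0// ltW.
Qed.

End RandomMatrices.

(** * The dyadic step function and its mean *)

Section Levels.
Variable R : realType.

(** Level 0 is the whole line, so that the constant 1 of [dyadic] is a term like the others. *)
Definition level (l : nat) : set R :=
  if l is l'.+1 then `]2 ^+ l', +oo[ else setT.

Definition level_weight (l : nat) : R := if l is l'.+1 then 2 ^+ l' else 1.

(* [1 + \sum_(l < L) 2 ^+ l * \1_(x > 2 ^+ l)] *)
Definition dyadic (L : nat) (x : R) : R :=
  \sum_(l < L.+1) level_weight l * \1_(level l) x.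

Lemma measurable_level l : measurable (level l).
Proof. by case: l => [|l] //=; exact: measurable_itv. Qed.

Lemma level_weight_ge0 l : 0 <= level_weight l.
Proof. by case: l => [|l] //=; exact: exprn_ge0. Qed.

Lemma dyadic0 x : dyadic 0 x = 1.
Proof. by rewrite /dyadic big_ord1 /= indicT mulr1. Qed.

Lemma dyadicS L x : dyadic L.+1 x = dyadic L x + (if 2 ^+ L < x then 2 ^+ L else 0).
Proof.
rewrite /dyadic big_ord_recr /=; congr (_ + _).
by rewrite indicE mem_setE in_itv /= andbT; case: ifP; rewrite ?mulr1 ?mulr0.
Qed.

Lemma dyadic_ge1 L x : 1 <= dyadic L x.
Proof.
elim: L => [|L IH]; first by rewrite dyadic0.
by rewrite dyadicS (le_trans IH)// lerDl; case: ifP => // _; exact: exprn_ge0.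
Qed.

Lemma dyadic_ge L x : x <= 2 ^+ L -> x <= dyadic L x.
Proof.
(* The minimum makes the induction work: if [2 ^+ L < x], then [dyadic L x] is already at least
   [2 ^+ L], and the new jump doubles this bound. *)
suff: Num.min x (2 ^+ L) <= dyadic L x by move=> H /min_idPl xL; rewrite xL in H.
elim: L => [|L IH]; first by rewrite dyadic0 expr0 ge_min lexx orbT.
rewrite dyadicS; case: ifPn => [Lx|]; last first.
  by rewrite -leNgt addr0 => xL; rewrite ge_min (le_trans _ IH)// le_min lexx xL.
rewrite ge_min exprS mulr_natl mulr2n lerD2r.
by move: IH; rewrite (min_idPr (ltW Lx)) => ->; rewrite orbT.
Qed.

Lemma dyadic_le L x : dyadic L x <= 1 + 2 * `|x|.
Proof.
(* The second bound feeds the first: after a jump at [2 ^+ L < x], the value is at most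
   [2 * 2 ^+ L < 2 * x]. *)
suff [//] : dyadic L x <= 1 + 2 * `|x| /\ dyadic L x <= 2 ^+ L.
elim: L => [|L [IH1 IH2]].
  by rewrite dyadic0 expr0; split => //; rewrite lerDl mulr_ge0.
rewrite dyadicS exprS; case: ifPn => [Lx|_].
  by split; have := ler_norm x; lra.
by rewrite addr0; split => //; rewrite (le_trans IH2)// ler_peMl ?exprn_ge0// ler1n.
Qed.

Section Moment.
Context d (T : measurableType d) (P : probability T R).

Lemma measurable_preimage_level (X : {RV P >-> R}) l : measurable (X @^-1` level l).
Proof.
rewrite -[X in measurable X]setTI.
by apply: measurable_funP => //; exact: measurable_level.
Qed.

(** The sum is the mean of [dyadic L] at [X], hence at most the mean of [1 + 2 * |X|], whatever [L]
    is. *)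
Lemma level_moment_bounded (X : {RV P >-> R}) (p : nat -> R) :
  P.-integrable setT (EFin \o X) ->
  (forall l, P (X @^-1` level l) = (p l)%:E) ->
  exists C, forall L, \sum_(l < L.+1) level_weight l * p l <= C.
Proof.
move=> iX Xp.
have mX : measurable_fun setT X by exact: measurable_funP.
have i1 : P.-integrable setT (fun w => (1 + 2 * `|X w|)%:E).
  have -> : (fun w => (1 + 2 * `|X w|)%:E) =
      (cst 1%:E \+ (fun w => 2%:E * `|(EFin \o X) w|))%E.
    by apply/funext => w /=; rewrite EFinD EFinM.
  apply: integrableD => //; first exact: finite_measure_integrable_cst.
  by apply: integrableZl => //; exact: integrable_abse.
exists (fine (\int[P]_w (1 + 2 * `|X w|)%:E)) => L.
rewrite -lee_fin fineK; last exact: integrable_fin_num.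
have mI l : measurable_fun setT (fun w => \1_(X @^-1` level l) w : R).
  by apply: measurable_indic; exact: measurable_preimage_level.
have -> : ((\sum_(l < L.+1) level_weight l * p l)%:E =
    \int[P]_w (\sum_(l < L.+1) (level_weight l)%:E * (\1_(X @^-1` level l) w)%:E))%E.
  rewrite ge0_integral_sum//; last 2 first.
  - by move=> l; apply: measurable_funeM; exact/measurable_EFinP.
  - by move=> l w _; rewrite mule_ge0// lee_fin level_weight_ge0.
  rewrite -sumEFin; apply: eq_bigr => l _.
  rewrite ge0_integralZl_EFin ?level_weight_ge0//; last exact/measurable_EFinP.
  rewrite integral_indic//; last exact: measurable_preimage_level.
  by rewrite setIT EFinM; congr (_ * _)%E; rewrite -Xp.
apply: ge0_le_integral => //.
- by move=> w _; apply: sume_ge0 => l _; rewrite mule_ge0// lee_fin level_weight_ge0.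
- apply: emeasurable_sum => l; apply: measurable_funeM; exact/measurable_EFinP.
- by case/integrableP : i1.
move=> w _; rewrite -[X in (_ <= X)%E]/(1 + 2 * `|X w|)%:E.
under eq_bigr do rewrite -EFinM.
by rewrite sumEFin lee_fin; exact: (dyadic_le L (X w)).
Qed.

End Moment.

End Levels.

(** * Tail of the product of row means *)

Section ProductTail.
Context d (T : measurableType d) (R : realType) (P : probability T R).

(* Expanding the product over the rows and the sum over the columns and levels
   leaves only probabilities of finite intersections of independent events. *)
Lemma prob_le_prod_dyadic (m n L : nat) (X : 'I_m -> 'I_n -> {RV P >-> R})
    (p : nat -> R) (C t : R) :
  (0 < n)%N -> mutually_independent (fun ij : 'I_m * 'I_n => X ij.1 ij.2) ->
  (forall i j l, P (X i j @^-1` level l) = (p l)%:E) ->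
  \sum_(l < L.+1) level_weight R l * p l <= C -> 0 < t ->
  prob_le P
    [set w | t < \prod_i (n%:R^-1 * \sum_j dyadic L (X i j w))] (C ^+ m / t).
Proof.
move=> n0 X_indep Xp pC t0.
(* Without rows [Xp] says nothing about [p]. *)
have p0 l : (0 < m)%N -> 0 <= p l.
  by case: m X X_indep Xp => [//|m'] X _ Xp _; rewrite -lee_fin -(Xp ord0
      (Ordinal n0) l) measure_ge0.
(* A term of the expanded product chooses a column and a level in every row. *)
pose S := {ffun 'I_m -> 'I_n * 'I_L.+1}.
pose E (F : S) := [set w | forall i, level (F i).2 (X i (F i).1 w)].
pose c (F : S) : R := \prod_i (n%:R^-1 * level_weight R (F i).2).
pose r (F : S) : R := \prod_i p (F i).2.
have c0 F : 0 <= c F.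
  by apply: prodr_ge0 => i _; rewrite mulr_ge0 ?invr_ge0// level_weight_ge0.
have mE F : measurable (E F).
  rewrite (_ : E F = \bigcap_(i in [set: 'I_m]) (X i (F i).1 @^-1` level (F i).2)).
    by apply: fin_bigcap_measurable => // i _; exact: measurable_preimage_level.
  by apply/seteqP; split => w Hw i; [move=> _|]; exact: Hw.
have Er F : P (E F) = (r F)%:E.
  pose phi i := (i, (F i).1).
  have phi_inj : injective phi by move=> i i' [].
  pose B (ij : 'I_m * 'I_n) : set R := level (F ij.1).2.
  have -> : E F = [set w | forall ij, ij \in (phi @: [set: 'I_m])%SET -> B ij
      (X ij.1 ij.2 w)].
    apply/seteqP; split => w Hw.
      by move=> _ /imsetP[i _ ->]; exact: Hw.
    by move=> i; apply: (Hw (phi i)); exact: imset_f.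
  rewrite X_indep => [|ij]; last exact: measurable_level.
  rewrite big_imset /=; last by move=> i i' _ _; exact: phi_inj.
  rewrite (eq_bigr (fun i => (p (F i).2)%:E)) => [|i _]; last exact: Xp.
  by rewrite prodEFin; congr (_%:E); apply: eq_bigl => i; rewrite inE.
have := prob_le_Markov c0 mE Er t0; apply: prob_leW.
  move=> w /= /lt_le_trans; apply.
  rewrite (eq_bigr (fun i => \sum_(jl : 'I_n * 'I_L.+1)
      n%:R^-1 * level_weight R jl.2 * \1_(level jl.2) (X i jl.1 w))).
    rewrite bigA_distr_bigA /=; apply: ler_sum => F _.
    rewrite big_split /= -/(c F) ler_wpM2l//.
    rewrite indicE; case: (boolP (w \in E F)) => [/set_mem Ew|NE].
      by rewrite big1// => i _; rewrite indicE mem_set//; exact: Ew.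
    have [i NEi] : exists i, ~ level (F i).2 (X i (F i).1 w).
      apply/existsNP => Ew; case/negP: NE; exact: mem_set.
    by rewrite (bigD1 i)//= indicE memNset// mul0r.
  move=> i _; rewrite mulr_sumr -(pair_big xpredT xpredT (fun (j : 'I_n)
      (l : 'I_L.+1) => n%:R^-1 * level_weight R l * \1_(@level R l) (X i j w)))/=.
  apply: eq_bigr => j _; rewrite /dyadic mulr_sumr.
  by apply: eq_bigr => l _; rewrite mulrA.
rewrite ler_pM2r ?invr_gt0//.
(* The expansion is undone on the level of means: each row contributes the moment sum, at most
   [C]. *)
rewrite (_ : \sum_s _ = \prod_(i < m) \sum_(jl : 'I_n * 'I_L.+1)
    n%:R^-1 * level_weight R jl.2 * p jl.2); last first.
  by rewrite bigA_distr_bigA/=; apply: eq_bigr => F _; rewrite -big_split.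
rewrite -[m in C ^+ m]card_ord -prodr_const; apply: ler_prod => i _.
have m0 : (0 < m)%N by exact: leq_ltn_trans (ltn_ord i).
apply/andP; split.
  apply: sumr_ge0 => jl _.
  by rewrite mulr_ge0 ?p0// mulr_ge0 ?invr_ge0// level_weight_ge0.
rewrite -(pair_big xpredT xpredT (fun (j : 'I_n) (l : 'I_L.+1) =>
    n%:R^-1 * level_weight R l * p l))/=.
rewrite sumr_const card_ord.
under eq_bigr do rewrite -mulrA.
by rewrite -mulr_sumr -[_ *+ n]mulr_natl mulVKf// pnatr_eq0 -lt0n.
Qed.

End ProductTail.

(** * Almost sure bounds for all large [n] *)

(** The base 16 beats the [2 ^ n] subsets of a line and leaves [n ^ 3]: one factor for the number of
    lines, two for summability. *)
Lemma expn16_ge n : (n ^ 3 * 2 ^ n <= 16 ^ n)%N.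
Proof.
rewrite (_ : 16 ^ n = (2 ^ n) ^ 3 * 2 ^ n)%N; last by rewrite -expnM -expnD -(expnM 2
    4); congr expn; lia.
by rewrite leq_mul2r leq_exp2r// ltnW ?orbT// ltn_expl.
Qed.

Section RatioBounds.
Context (R : realType)
  d (T : measurableType d) (P : probability T R)
  d' (T' : measurableType d') (P' : probability T' R) (xi : {RV P' >-> R})
  (m : nat -> nat)
  (m_bounds : forall n : nat, (0 < n)%N -> (0 < m n)%N /\ (m n <= n)%N)
  (X : forall n : nat, 'I_(m n) -> 'I_n -> {RV P >-> R}).
Arguments X : clear implicits.
Context
  (X_pos : forall (n : nat) (i : 'I_(m n)) (j : 'I_n),
    {ae P, forall w, 0 < X n i j w})
  (X_indep : forall n : nat,
    mutually_independent (fun ij : 'I_(m n) * 'I_n => X n ij.1 ij.2))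
  (X_xi : forall (n : nat) (i : 'I_(m n)) (j : 'I_n),
    identically_distributed (X n i j) xi)
  (alpha : R) (alpha_gt0 : 0 < alpha).

Lemma ae_all_pos : {ae P, forall w, forall n i j, 0 < X n i j w}.
Proof.
apply: ae_foralln => n; apply: filter_forall => i; apply: filter_forall => j.
exact: X_pos.
Qed.

(** The law of [xi] gives no mass to the nonpositive numbers, as seen on an entry of the matrix for
    [n = 1]; right continuity of the distribution function at 0 does the rest. *)
Lemma exists_small_cdf (q : R) : 0 < q ->
  exists delta p, [/\ 0 < delta, 0 <= p <= 1, p <= q &
    P' (xi @^-1` `]-oo, delta]) = p%:E].
Proof.
move=> q0.
have xi0 : cdf xi 0 = 0%E.
  have [m1 _] := m_bounds (ltn0Sn 0).
  have [N [mN PN NX]] := X_pos (Ordinal m1) ord0.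
  have := X_xi (Ordinal m1) ord0 (measurable_itv (Interval -oo%O (BRight (0 : R)))).
  rewrite /cdf => <-; apply: (subset_measure0 _ mN _ PN).
    by rewrite -[X in measurable X]setTI; exact: measurable_funP.
  by move=> w /=; rewrite in_itv /= => Xw; apply: NX => /=; rewrite ltNge Xw.
have cdf_q : \forall x \near 0^'+, (cdf xi x < q%:E)%E.
  apply: (@cdf_right_continuous _ _ _ P' xi 0 [set y | (y < q%:E)%E]).
  rewrite xi0; apply: open_nbhs_nbhs; split; first exact: open_ereal_lt_ereal.
  by rewrite /= lte_fin.
have [delta [d0 dq]] : exists delta, 0 < delta /\ (cdf xi delta < q%:E)%E.
  apply: (@filter_ex _ (0^'+)); near=> x; split; near: x => //.
  exact: nbhs_right_gt.
exists delta, (fine (cdf xi delta)).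
have cE : cdf xi delta = (fine (cdf xi delta))%:E.
  rewrite fineK// ge0_fin_numE ?cdf_ge0//; exact: lt_trans dq (ltry _).
split => //.
- by rewrite -!lee_fin -cE cdf_ge0 cdf_le1.
- by rewrite -lee_fin -cE ltW.
Unshelve. all: by end_near. Qed.

Lemma ae_log_per_ratio_ge (eps : R) : 0 < eps <= 1 ->
  {ae P, forall w, \forall n \near \oo,
    forall IJ : {set 'I_(m n)} * {set 'I_n}, admissible alpha IJ ->
      1 - eps <= log_per_ratio (random_matrix (X n) w) IJ}.
Proof.
move=> e01; have [e0 _] := andP e01.
have [D hD] : exists D : nat, 4 + 2 * eps <= eps * alpha * D%:R.
  have ea0 : 0 < eps * alpha by exact: mulr_gt0.
  exists (Num.truncn ((4 + 2 * eps) / (eps * alpha))).+1.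
  by rewrite -ler_pdivrMl// mulrC ltW// truncnS_gt.
have D0 : (0 < D)%N.
  rewrite lt0n; apply/eqP => D0; move: hD; rewrite D0 mulr0; lra.
(* Since [n < D * (h + 1)] for [h = n %/ D], a probability [p <= 16 ^ -D] gives
   [p ^ h <= 16 ^ D / 16 ^ n]. *)
have q0 : 0 < (16 ^+ D)^-1 :> R by rewrite invr_gt0 exprn_gt0.
have [delta [p [d0 p01 pq xip]]] := exists_small_cdf q0.
have [p0 p1] := andP p01.
have BC : \forall n \near \oo, prob_le P
    [set w | ~ ((forall i, #|[set j | (X n i j w <= delta)%R]%SET| <= n %/ D)%N /\
                (forall j, #|[set i | (X n i j w <= delta)%R]%SET| <= n %/ D)%N)]
    (2 * 16 ^+ D / n%:R ^+ 2).
  near=> n; have n0 : (0 < n)%N by near: n; exact: nbhs_infty_gt.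
  have [_ mn] := m_bounds n0.
  have := prob_le_bad_line (n %/ D) mn (@X_indep n) p01
    (fun i j => etrans (X_xi i j (measurable_itv _)) xip).
  apply: prob_leW => //.
  rewrite ler_pdivlMr ?exprn_gt0 ?ltr0n//.
  set h := (n %/ D)%N.
  have ph : 16 ^+ (D * h) * p ^+ h <= 1.
    rewrite exprM -exprMn exprn_ile1//; first by rewrite mulr_ge0// exprn_ge0.
    by rewrite mulrC -ler_pdivlMr ?exprn_gt0// div1r.
  have h16 : n%:R ^+ 3 * 2 ^+ n <= 16 ^+ D * 16 ^+ (D * h) :> R.
    apply: (@le_trans _ _ (16 ^+ n)).
      by rewrite -!natrX -natrM ler_nat expn16_ge.
    rewrite -exprD ler_weXn2l ?ler1n//.
    by rewrite -mulnS mulnC ltnW// ltn_ceil.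
  have := ler_wpM2r (exprn_ge0 h p0) h16.
  have := ler_wpM2l (exprn_ge0 D (ler0n R 16)) ph.
  rewrite mulr1 mulrA => h1 h2; have := le_trans h2 h1.
  rewrite (_ : 2 * n%:R * 2 ^+ n * p ^+ h * n%:R ^+ 2 = 2 *
      (n%:R ^+ 3 * 2 ^+ n * p ^+ h)); last by ring.
  by move=> h3; rewrite ler_pM2l.
have := Borel_Cantelli BC; apply: filterS2 ae_all_pos => w Xw0 BCw.
near=> n => IJ adm.
have n0 : (0 < n)%N by near: n; exact: nbhs_infty_gt.
have [m0 _] := m_bounds n0.
have /contrapT[row col] : ~ ~ ((forall i, #|[set j | (X n i j w <= delta)%R]%SET| <=
    n %/ D)%N /\
                (forall j, #|[set i | (X n i j w <= delta)%R]%SET| <= n %/ D)%N).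
  by near: n.
have : forall (m' : nat) (A : 'M[R]_(m', n)) (IJ : {set 'I_m'} * {set 'I_n}),
    (0 < m')%N -> (forall i j, 0 <= A i j) ->
    (forall i, (#|[set j | (A i j <= delta)%R]%SET| <= n %/ D)%N) ->
    (forall j, (#|[set i | (A i j <= delta)%R]%SET| <= n %/ D)%N) ->
    admissible alpha IJ -> 1 - eps <= log_per_ratio A IJ.
  by near: n; exact: log_per_ratio_ge.
apply => //.
- by move=> i j; rewrite mxE ltW.
- move=> i; apply: leq_trans (row i); apply/eq_leq/eq_card => j.
  by rewrite !inE mxE.
- move=> j; apply: leq_trans (col j); apply/eq_leq/eq_card => i.
  by rewrite !inE mxE.
Unshelve. all: by end_near. Qed.

(** As [ln (ln n) <= ln n], the quotient in [m_growth] is at most [m n]. *)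
Lemma near_m_ge
    (m_growth : (m n)%:R * ln (ln (n%:R : R)) / ln (n%:R : R) @[n --> \oo] --> +oo)
    (K : R) : \forall n \near \oo, K <= (m n)%:R.
Proof.
have /cvgryPge/(_ K) mK := m_growth.
near=> n.
have ln_gt0 : 1 <= ln (n%:R : R) by near: n; exact: near_ln_ge.
have : K <= (m n)%:R * ln (ln n%:R) / ln n%:R by near: n.
move/le_trans; apply; rewrite -mulrA ler_piMr//.
rewrite ler_pdivrMr ?mul1r; last exact: lt_le_trans ln_gt0.
have := @le_ln1Dx R (ln n%:R - 1); rewrite (addrC 1) subrK => /(_ _)/le_trans; apply;
    last by lra.
by lra.
Unshelve. all: by end_near. Qed.

(** Two events are excluded: [W] exceeds [t n], or some entry exceeds [2 ^ (4n)], beyond which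
    [dyadic (4 * n)] need not dominate it. *)
Lemma ae_log_per_ratio_le (eps : R) :
  (forall K : R, \forall n \near \oo, K <= (m n)%:R) -> 0 < eps ->
  P'.-integrable setT (EFin \o xi) ->
  {ae P, forall w, \forall n \near \oo,
    forall IJ : {set 'I_(m n)} * {set 'I_n}, admissible alpha IJ ->
      log_per_ratio (random_matrix (X n) w) IJ <= 1 + eps}.
Proof.
move=> m_oo e0 ixi.
pose p l := fine (P' (xi @^-1` level l)).
have xip l : P' (xi @^-1` level l) = (p l)%:E.
  rewrite /p fineK// fin_num_measure//; exact: measurable_preimage_level.
have Xp n i j l : P (X n i j @^-1` level l) = (p l)%:E.
  exact: etrans (X_xi i j (measurable_level l)) (xip l).
have [C0 pC0] := level_moment_bounded ixi xip.
pose C := Num.max C0 1.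
have pC L : \sum_(l < L.+1) level_weight R l * p l <= C.
  by rewrite le_max pC0.
have C1 : 1 <= C by rewrite le_max lexx orbT.
have Cgt0 : 0 < C by exact: lt_le_trans C1.
have p0 l : 0 <= p l by rewrite fine_ge0.
(* Markov's inequality for [xi], read off a single term of the moment sum; level [L.+1] starts at
   [2 ^+ L]. *)
have p_le L : p L.+1 <= C / 2 ^+ L.
  rewrite ler_pdivlMr ?exprn_gt0// mulrC; apply: le_trans (pC L.+1).
  rewrite big_ord_recr/= lerDr; apply: sumr_ge0 => l _.
  by rewrite mulr_ge0// level_weight_ge0.
pose eta := eps * alpha / 2.
have eta0 : 0 < eta by rewrite divr_gt0// mulr_gt0.
pose t n := expR (eta * (m n)%:R * ln n%:R).
pose W n w := \prod_i (n%:R^-1 * \sum_j dyadic (4 * n) (X n i j w)).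
have BC : \forall n \near \oo, prob_le P
    ([set w | t n < W n w] `|` [set w | exists2 ij : 'I_(m n) * 'I_n, true & level
        (4 * n).+1 (X n ij.1 ij.2 w)])
    ((1 + C) / n%:R ^+ 2).
  near=> n; have n0 : (0 < n)%N by near: n; exact: nbhs_infty_gt.
  have nR0 : 0 < n%:R :> R by rewrite ltr0n.
  have [m0 mn] := m_bounds n0.
  rewrite mulrDl mul1r; apply: prob_leU.
    have := prob_le_prod_dyadic n0 (@X_indep n) (@Xp n) (pC (4 * n)%N) (expR_gt0
        (eta * (m n)%:R * ln n%:R)).
    apply: prob_leW => //.
    have nE : n%:R = expR (ln n%:R) :> R by rewrite lnK.
    have CE : C = expR (ln C) by rewrite lnK.
    rewrite -expRN [in X in X <= _]CE -expRM_natl -expRD.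
    rewrite [in X in _ <= X]nE -expRM_natl -expRN ler_expR.
    (* Half of [eta * m n * ln n] absorbs [m n * ln C]; the other half is at least [2 * ln n] once
       [eta * m n >= 4], which is where [m n] must tend to infinity. *)
    have lnn : 2 / eta * ln C <= ln (n%:R : R) by near: n; exact: near_ln_ge.
    have ln0 : 0 <= ln (n%:R : R) by near: n; exact: near_ln_ge.
    have mbig : 4 / eta <= (m n)%:R by near: n; exact: m_oo.
    have lnn' : 2 * ln C <= eta * ln n%:R.
      by move: lnn; rewrite mulrAC ler_pdivrMr// [_ * eta]mulrC.
    have mbig' : 4 <= eta * (m n)%:R by move: mbig; rewrite ler_pdivrMr// mulrC.
    have := ler_wpM2l (ler0n R (m n)) lnn'.
    have := ler_wpM2r ln0 mbig'.
    lra.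
  have tail (ij : 'I_(m n) * 'I_n) : prob_le P [set w | level (4 * n).+1
      (X n ij.1 ij.2 w)] (C / 2 ^+ (4 * n)).
    exists (X n ij.1 ij.2 @^-1` level (4 * n).+1); split => //.
      exact: measurable_preimage_level.
    by rewrite Xp lee_fin p_le.
  have := prob_le_bigU (Q := xpredT) (fun ij _ => tail ij).
  apply: prob_leW => //.
  rewrite sumr_const card_prod !card_ord -[_ *+ _]mulr_natl mulrCA ler_pM2l//.
  rewrite -[leRHS]div1r ler_pdivlMr ?exprn_gt0// mulrAC ler_pdivrMr ?exprn_gt0// mul1r.
  rewrite -!natrX -!natrM ler_nat mulnC expnM.
  (* At most [n ^ 2] entries and the required [n ^ 2] give [n ^ 4 <= 16 ^ n], which explains the
     level [4 * n]. *)
  apply: (@leq_trans (n ^ 4)).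
    rewrite (_ : n ^ 4 = n ^ 2 * (n * n))%N; last by rewrite !expnS expn0; lia.
    by rewrite leq_mul2l leq_mul2r mn !orbT.
  by rewrite -expnM mulnC expnM leq_exp2r// ltnW// ltn_expl.
have := Borel_Cantelli BC; apply: filterS2 ae_all_pos => w Xw0 BCw.
near=> n => IJ adm.
have n0 : (0 < n)%N by near: n; exact: nbhs_infty_gt.
have [m0 _] := m_bounds n0.
have /not_orP[/negP] : ~ (([set w | t n < W n w] `|` [set w | exists2 ij : 'I_(m n) *
    'I_n, true & level (4 * n).+1 (X n ij.1 ij.2 w)]) w).
  by near: n.
rewrite -leNgt => Wt NX.
have : forall (m' : nat) (A : 'M[R]_(m', n)) (IJ : {set 'I_m'} * {set 'I_n}),
    (0 < m')%N ->
    per (submatrix A IJ.1 IJ.2) <=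
      n%:R ^+ #|IJ.1| * expR (eps * alpha / 2 * m'%:R * ln n%:R) ->
    admissible alpha IJ -> log_per_ratio A IJ <= 1 + eps.
  by near: n; exact: log_per_ratio_le.
apply => //.
apply: (@le_trans _ _ (n%:R ^+ #|IJ.1| * W n w)); last first.
  by rewrite ler_wpM2l ?exprn_ge0.
have := @per_submatrix_le_mean R (m n) n (random_matrix (X n) w)
  (\matrix_(i, j) dyadic (4 * n) (X n i j w)) IJ.1 IJ.2 n0.
have -> : \prod_i (n%:R^-1 * \sum_j (\matrix_(i, j) dyadic (4 * n)
    (X n i j w)) i j) = W n w.
  by apply: eq_bigr => i _; congr (_ * _); apply: eq_bigr => j _; rewrite mxE.
apply => i j; rewrite !mxE ?dyadic_ge1// ltW//=; apply: dyadic_ge.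
rewrite leNgt; apply/negP => Xbig; apply: NX.
by exists (i, j) => //=; rewrite in_itv/= Xbig.
Unshelve. all: by end_near. Qed.

End RatioBounds.

(** * From fixed tolerances to the limits *)

Theorem theorem21 (R : realType)
    (d : measure_display) (T : measurableType d) (P : probability T R)
    (d' : measure_display) (T' : measurableType d') (P' : probability T' R)
    (xi : {RV P' >-> R})
    (m : nat -> nat)
    (m_bounds : forall n : nat, (0 < n)%N -> (0 < m n)%N /\ (m n <= n)%N)
    (m_growth :
      (m n)%:R * ln (ln (n%:R : R)) / ln (n%:R : R) @[n --> \oo] --> +oo)
    (X : forall n : nat, 'I_(m n) -> 'I_n -> {RV P >-> R})
    (X_pos : forall (n : nat) (i : 'I_(m n)) (j : 'I_n),
      {ae P, forall w, 0 < X n i j w})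
    (X_indep : forall n : nat,
      mutually_independent (fun ij : 'I_(m n) * 'I_n => X n ij.1 ij.2))
    (X_xi : forall (n : nat) (i : 'I_(m n)) (j : 'I_n),
      identically_distributed (X n i j) xi)
    (alpha : R) (alpha_gt0 : 0 < alpha) (alpha_lt1 : alpha < 1) :
  {ae P, forall w,
    (1 <= limn_einf (fun n => min_ratio alpha (random_matrix (X n) w)))%E} /\
  (P'.-integrable setT (EFin \o xi) ->
   {ae P, forall w,
     limn_esup (fun n => max_ratio alpha (random_matrix (X n) w)) = 1%E}).
Proof.
(* Countably many tolerances, so that the exceptional null sets can be united. *)
pose e k : R := k.+1%:R^-1.
have e01 k : 0 < e k <= 1 by rewrite invr_gt0 ltr0n/= invf_le1 ?ler1n ?ltr0n.
have e_small (r : R) : 0 < r -> exists k, e k <= r.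
  move=> r0; exists (Num.truncn r^-1).
  by rewrite invf_ple ?posrE ?ltr0n// ltW// truncnS_gt.
have lower : {ae P, forall w, forall k, \forall n \near \oo,
    forall IJ : {set 'I_(m n)} * {set 'I_n}, admissible alpha IJ ->
      1 - e k <= log_per_ratio (random_matrix (X n) w) IJ}.
  apply: ae_foralln => k.
  exact: (ae_log_per_ratio_ge m_bounds X_pos X_indep X_xi alpha_gt0 (e01 k)).
have liminf_ge : {ae P, forall w,
    (1 <= limn_einf (fun n => min_ratio alpha (random_matrix (X n) w)))%E}.
  apply: filterS lower => w Hw; apply/lee_subgt0Pr => r r0.
  have [k ekr] := e_small r r0.
  apply: limn_einf_ge; near=> n.
  apply: le_bigmin => [|IJ adm]; first exact: leey.
  rewrite -EFinB lee_fin; apply: (@le_trans _ _ (1 - e k)); first by rewrite lerB.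
  by move: IJ adm; near: n; exact: Hw.
split => // ixi.
have upper : {ae P, forall w, forall k, \forall n \near \oo,
    forall IJ : {set 'I_(m n)} * {set 'I_n}, admissible alpha IJ ->
      log_per_ratio (random_matrix (X n) w) IJ <= 1 + e k}.
  apply: ae_foralln => k; have /andP[ek0 _] := e01 k.
  exact: (ae_log_per_ratio_le m_bounds X_pos X_indep X_xi alpha_gt0
    (near_m_ge m_growth) ek0 ixi).
apply: filterS2 lower upper => w Lw Uw; apply/eqP; rewrite eq_le; apply/andP; split.
  apply/lee_addgt0Pr => r r0; have [k ekr] := e_small r r0.
  apply: limn_esup_le; near=> n.
  apply: bigmax_le => [|IJ adm]; first exact: leNye.
  rewrite -EFinD lee_fin; apply: (@le_trans _ _ (1 + e k)); last by rewrite lerD2l.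
  by move: IJ adm; near: n; exact: Uw.
(* The upper limit is at least the lower limit of the same maxima, and for [n >= 1] each maximum is
   at least the ratio of the full matrix, which is admissible. *)
apply/lee_subgt0Pr => r r0; have [k ekr] := e_small r r0.
apply: le_trans (limn_einf_sup _); apply: limn_einf_ge; near=> n.
have [_ mn] : (0 < m n)%N /\ (m n <= n)%N.
  by apply: m_bounds; near: n; exact: nbhs_infty_gt.
have adm : admissible alpha ([set: 'I_(m n)]%SET, [set: 'I_n]%SET).
  by rewrite /admissible /= !cardsT !card_ord mn !ler_piMl// ltW.
apply: le_trans (le_bigmax_cond _ _ adm).
rewrite -EFinB lee_fin; apply: (@le_trans _ _ (1 - e k)); first by rewrite lerB.
by move: adm; move: (_, _); near: n; exact: Lw.
Unshelve. all: by end_near. Qed.
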